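(* Let $X\neq\{0\}$ be a Banach space over $\mathbb{F}$ ($\mathbb{F}=\mathbb{R}$ or $\mathbb{C}$) such that the numerical radius $w(\cdot)$ is a norm on $L(X)$. Then $E_{B_{L(X)_w^*}}\subseteq \overline{\mathscr{M}}^{\,weak^*}$, where $$\mathscr{M}:=\{x^*\otimes x: x^*\in E_{B_{X^*}},\ x\in S_X,\ |x^*(x)|=1\}.$$
   Context: For a normed space $Z$ over $\mathbb{F}$, $B_Z$ and $S_Z$ denote the closed unit ball and unit sphere, $Z^*$ the topological dual, and $E_C$ the set of extreme points of a convex set $C$. $L(X)$ is the space of bounded linear operators $X\to X$. For $T\in L(X)$ the numerical radius is $w(T)=\sup\{|x^*(Tx)|: x^*\in S_{X^*}, x\in S_X, x^*(x)=1\}$. $L(X)_w$ denotes the vector space $L(X)$ normed by $w(\cdot)$, and $L(X)_w^*$ its dual, with the dual norm. For $x\in X$, $x^*\in X^*$, $x^*\otimes x$ denotes the linear functional on $L(X)_w$ given by $[x^*\otimes x](T)=x^*(Tx)$. The weak* topology on $L(X)_w^*$ is that of pointwise convergence on $L(X)_w$. *)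

(* Defs.v *)
From HB Require Import structures.
From mathcomp Require Import all_boot all_order all_algebra.
From mathcomp Require Import all_classical all_reals all_analysis.
From mathcomp Require Export complex.

Set Implicit Arguments.
Unset Strict Implicit.
Unset Printing Implicit Defensive.

Import Order.TTheory GRing.Theory Num.Theory.
Import numFieldNormedType.Exports.

Local Open Scope classical_set_scope.
Local Open Scope ring_scope.

(* All definitions are over an arbitrary [K : numFieldType] and are meant for
   [K = R] and [K = R[i]] with [R : realType]. Norms are [K]-valued, and on
   [R[i]] the order [a <= b] means [Re a <= Re b] and [Im a = Im b]; so the
   [supremum] of a nonempty bounded set of norms is its usual supremum, and
   [0 < t] says that [t] is a positive real. *)

Section BoundedOperators.
Context {K : numFieldType} (V W : normedModType K).

Definition bounded_linear : {pred V -> W} := fun f =>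
  `[< linear f /\ exists M : K, forall x, `|f x| <= M * `|x| >].

Lemma bounded_linear_submod_closed : submod_closed bounded_linear.
Proof.
split=> [|a f g /asboolP[fl [M fM]] /asboolP[gl [N gN]]]; apply/asboolP.
  split=> [b x y|]; first by rewrite /= scaler0 addr0.
  by exists 0 => x; rewrite /= normr0 mul0r.
split=> [b x y|].
  rewrite !fctE fl gl !scalerDr !scalerA mulrC -!addrA; congr (_ + _).
  by rewrite addrCA.
exists (`|a| * M + N) => x; rewrite !fctE.
rewrite (le_trans (ler_normD _ _))// mulrDl lerD// normrZ -mulrA.
by rewrite ler_wpM2l.
Qed.

HB.instance Definition _ :=
  GRing.isSubmodClosed.Build K (V -> W) bounded_linear
    bounded_linear_submod_closed.

Record bop := Bop {
  bop_fun :> V -> W;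
  bop_funP : bop_fun \in bounded_linear }.

HB.instance Definition _ := [isSub for bop_fun].
HB.instance Definition _ := [Choice of bop by <:].
HB.instance Definition _ := [SubChoice_isSubLmodule of bop by <:].

End BoundedOperators.

Section BoundedOperatorsTheory.
Context {K : numFieldType} (V W : normedModType K).

Lemma bop_linear (f : bop V W) : linear f.
Proof. by case: f => f /= /asboolP[]. Qed.

HB.instance Definition _ (f : bop V W) :=
  GRing.isLinear.Build K V W *:%R (bop_fun f) (bop_linear f).

Lemma bounded_linear_continuousE (f : {linear V -> W}) :
  ((f : V -> W) \in @bounded_linear K V W) <-> continuous f.
Proof.
rewrite -linear_bounded_continuous linear_boundedP; split.
  move=> /asboolP[_ [M fM]].
  exists `|M|; split; first exact: normr_real.
  move=> r Mr x; apply: (le_trans (fM x)).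
  have [->|x0] := eqVneq x 0; first by rewrite normr0 !mulr0.
  have xp : 0 < `|x| by rewrite normr_gt0.
  have M0 : 0 <= M by rewrite -(pmulr_lge0 _ xp) (le_trans _ (fM x)).
  by rewrite ler_pM2r// (le_trans _ (ltW Mr))// ger0_norm.
move=> /pinfty_ex_gt0[M _ fM]; apply/asboolP.
by split; [exact: linearP|exists M].
Qed.

End BoundedOperatorsTheory.

Definition dual {K : numFieldType} (Z : normedModType K) := bop Z K^o.

Section Dual.
Context {K : numFieldType} (Z : normedModType K).

HB.instance Definition _ := GRing.Lmodule.on (dual Z).

Definition sphere : set Z := [set x | `|x| = 1].

Definition dual_norm (f : dual Z) : K :=
  supremum 0 [set `|f x| | x in [set x : Z | `|x| <= 1]].

Definition dual_ball : set (dual Z) := [set f | dual_norm f <= 1].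

Definition dual_sphere : set (dual Z) := [set f | dual_norm f = 1].

(* The initial topology of the inclusion of the dual in the space of all
   functions [Z -> K] with the topology of pointwise convergence. *)
Definition weak_star :=
  initial_topology (fun f : dual Z => (f : Z -> K^o) : {ptws Z -> K^o}).

HB.instance Definition _ := Topological.on weak_star.

Definition weak_star_closure (A : set (dual Z)) : set (dual Z) :=
  closure (A : set weak_star).

End Dual.

Definition extreme_points {K : numFieldType} {V : lmodType K} (C : set V) :
    set V :=
  [set x | C x /\ forall (y z : V) (t : K), C y -> C z -> 0 < t -> t < 1 ->
    x = t *: y + (1 - t) *: z -> y = x /\ z = x].

Record is_norm {K : numFieldType} {V : lmodType K} (n : V -> K) : Prop := {
  is_norm_triangle : forall x y, n (x + y) <= n x + n y;
  is_norm_scale : forall (a : K) x, n (a *: x) = `|a| * n x;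
  is_norm_eq0 : forall x, n x = 0 -> x = 0 }.

Definition numerical_radius {K : numFieldType} {X : normedModType K}
    (T : bop X X) : K :=
  supremum 0 [set r | exists (f : dual X) (x : X),
    [/\ dual_sphere f, sphere x, f x = 1 & r = `|f (T x)|]].

Section OperatorsNumericalRadius.
Context {K : numFieldType} {X : normedModType K}.
Hypothesis hw : is_norm (@numerical_radius K X).

(* The bounded operators on [X] as a normed space, the norm being the
   numerical radius. *)
Definition Lw of is_norm (@numerical_radius K X) : Type := bop X X.

HB.instance Definition _ := GRing.Lmodule.on (Lw hw).
HB.instance Definition _ := @Lmodule_isNormed.Build K (Lw hw)
  numerical_radius (is_norm_triangle hw) (is_norm_scale hw) (is_norm_eq0 hw).

Definition tensor (f : dual X) (x : X) : Lw hw -> K := fun T => f (T x).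

(* [tensor f x] is continuous for the numerical radius as soon as [f] and [x]
   are as below: if [f x = c] with [`|c| = 1], then [`|f (T x)|] is one of the
   values in the supremum defining [numerical_radius T], namely the one given
   by [c^-1 *: f] and [x]. So [phi : dual (Lw hw)] excludes no such tensor. *)
Definition extreme_tensors : set (dual (Lw hw)) :=
  [set phi | exists (f : dual X) (x : X),
    [/\ extreme_points (@dual_ball K X) f, sphere x, `|f x| = 1
      & (phi : Lw hw -> K) = tensor f x]].

End OperatorsNumericalRadius.

Arguments tensor {K X} hw f x _.
Arguments extreme_tensors {K X} hw _.

(* Main.v *)
(* By convexity the numerical radius of [T] is the supremum of [re phi T] over
   the extreme tensors [phi]: for fixed [x] the value [|f (T x)|] at a state [f]
   of [x] is dominated at an extreme point of the face [{g | g x = 1}] of the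
   dual ball. So the dual ball of [Lw] is the weak* closed convex hull of the
   extreme tensors, and Milman's theorem applies.

   Weak* compactness is never used: a weak* closed convex set is replaced by its
   support function, a sublinear functional, and faces by smaller sublinear
   functionals. A minimal one is linear by Zorn's lemma, which gives
   Hahn-Banach and Krein-Milman. Milman's theorem follows because an extreme
   functional dominated by [max p1 p2] is dominated by [p1] or by [p2]: hence
   the sets of tensors whose complement does not dominate [phi] form a filter,
   and this filter converges to [phi]. *)
Require Import Defs.
From HB Require Import structures.
From mathcomp Require Import all_boot all_order all_algebra.
From mathcomp Require Import all_classical all_reals all_analysis.
From mathcomp Require Import ring lra.

Set Implicit Arguments.
Unset Strict Implicit.
Unset Printing Implicit Defensive.

Import Order.TTheory GRing.Theory Num.Theory.
Import numFieldNormedType.Exports.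

Local Open Scope classical_set_scope.
Local Open Scope ring_scope.

(** * Sublinear functionals, their faces, and Hahn-Banach *)

Section Sublinear.
Context {R : realType} {V : lmodType R}.
Implicit Types (p q f g : V -> R) (x y : V).

Record sublinear p : Prop := {
  sublinearD : forall x y, p (x + y) <= p x + p y;
  sublinearZ : forall (r : R) x, 0 < r -> p (r *: x) <= r * p x }.

Lemma sublinear0 p : sublinear p -> p 0 = 0.
Proof.
move=> pS; have h : (0 : R) < 2^-1 by rewrite invr_gt0.
have := sublinearD pS 0 0; have := sublinearZ pS 0 h.
by rewrite addr0 scaler0; lra.
Qed.

Lemma sublinear_ge p x : sublinear p -> - p (- x) <= p x.
Proof.
move=> pS; have := sublinearD pS x (- x); rewrite subrr sublinear0//; lra.
Qed.

Lemma sublinear_scalar f : scalar f -> sublinear f.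
Proof.
move=> fL; have f0 : f 0 = 0.
  by have := fL (-1) 0 0; rewrite scaler0 addr0 /=; lra.
split=> [x y|r x _]; first by have := fL 1 x y; rewrite scale1r /= mul1r => ->.
by have := fL r x 0; rewrite !addr0 f0 addr0 /= => ->.
Qed.

Lemma scalar_funD f x y : scalar f -> f (x + y) = f x + f y.
Proof. by move=> fL; have := fL 1 x y; rewrite scale1r /= mul1r. Qed.

Lemma scalar_fun0 f : scalar f -> f 0 = 0.
Proof. by move=> /sublinear_scalar/sublinear0. Qed.

Lemma scalar_funZ f r x : scalar f -> f (r *: x) = r * f x.
Proof. by move=> fL; have := fL r x 0; rewrite !addr0 scalar_fun0// addr0. Qed.

Lemma scalar_funN f x : scalar f -> f (- x) = - f x.
Proof. by move=> fL; rewrite -scaleN1r scalar_funZ// mulN1r. Qed.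

Lemma scalar_le_eq f g : scalar f -> scalar g -> (forall x, f x <= g x) ->
  f = g.
Proof.
move=> fL gL fg; apply/funext => x; apply/eqP; rewrite eq_le fg/=.
by have := fg (- x); rewrite !scalar_funN// lerN2.
Qed.

Lemma sublinear_additive_scalar p : sublinear p ->
  (forall x y, p x + p y <= p (x + y)) -> scalar p.
Proof.
move=> pS pD.
have D x y : p (x + y) = p x + p y.
  by apply/eqP; rewrite eq_le pD (sublinearD pS).
have N x : p (- x) = - p x by have := D x (- x); rewrite subrr sublinear0//;
  lra.
have Zp r x : 0 < r -> p (r *: x) = r * p x.
  move=> r0; apply/eqP; rewrite eq_le sublinearZ//=.
  have ri : 0 < r^-1 by rewrite invr_gt0.
  have := sublinearZ pS (r *: x) ri; rewrite scalerA mulVf ?gt_eqF// scale1r.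
  by rewrite mulrC ler_pdivlMr// mulrC.
move=> r x y /=; rewrite D; congr (_ + _).
case: (ltgtP r 0) => [r0|r0|->]; last by rewrite scale0r mul0r sublinear0.
- have rp : 0 < - r by rewrite oppr_gt0.
  by have := Zp (- r) x rp; rewrite scaleNr N; lra.
- exact: Zp.
Qed.

Definition pointwise_inf (G : set (V -> R)) x := inf [set g x | g in G].

Lemma pointwise_inf_le (G : set (V -> R)) (b : V -> R) g x :
  (forall h y, G h -> b y <= h y) -> G g -> pointwise_inf G x <= g x.
Proof.
move=> Gb Gg; apply: ge_inf; last by exists g.
by exists (b x) => _ [h Gh <-]; exact: Gb.
Qed.

Lemma le_pointwise_inf (G : set (V -> R)) x c : G !=set0 ->
  (forall g, G g -> c <= g x) -> c <= pointwise_inf G x.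
Proof.
move=> [g Gg] Gc; apply: lb_le_inf; first by exists (g x), g.
by move=> _ [h Gh <-]; exact: Gc.
Qed.

(** The members of [G] need not be sublinear: it suffices that [G] absorbs sums and positive
    scalings up to domination by another member. The bound [b] keeps each [inf] from taking its
    default value. *)
Lemma sublinear_pointwise_inf (G : set (V -> R)) (b : V -> R) : G !=set0 ->
  (forall g x, G g -> b x <= g x) ->
  (forall g h, G g -> G h ->
    exists2 k, G k & forall x y, k (x + y) <= g x + h y) ->
  (forall g (r : R), G g -> 0 < r ->
    exists2 k, G k & forall x, k (r *: x) <= r * g x) ->
  sublinear (pointwise_inf G).
Proof.
move=> G0 Gb GD GZ; split=> [x y|r x r0].
- rewrite -lerBlDr; apply: le_pointwise_inf => // g Gg.
  rewrite lerBlDr -lerBlDl; apply: le_pointwise_inf => // h Gh.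
  rewrite lerBlDl; have [k Gk kle] := GD _ _ Gg Gh.
  exact: le_trans (pointwise_inf_le _ Gb Gk) (kle x y).
- rewrite mulrC -ler_pdivrMr//; apply: le_pointwise_inf => // g Gg.
  rewrite ler_pdivrMr// mulrC; have [k Gk kle] := GZ _ _ Gg r0.
  exact: le_trans (pointwise_inf_le _ Gb Gk) (kle x).
Qed.

(* A sublinear [q <= p] stands for the convex set of the linear functionals
   below it; [face_of p q] says that this set is a face of the one of [p]. *)
Record face_of p q : Prop := {
  face_sublinear : sublinear q;
  face_le : forall x, q x <= p x;
  face_extremal : forall f g (t : R), scalar f -> scalar g ->
    (forall x, f x <= p x) -> (forall x, g x <= p x) -> 0 < t -> t < 1 ->
    (forall x, t * f x + (1 - t) * g x <= q x) -> forall x, f x <= q x }.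

Lemma face_refl p : sublinear p -> face_of p p.
Proof. by split. Qed.

Lemma face_trans p q q' : face_of p q -> face_of q q' -> face_of p q'.
Proof.
move=> pq qq'; split; first exact: face_sublinear qq'.
  by move=> x; exact: le_trans (face_le qq' x) (face_le pq x).
move=> f g t fL gL fp gp t0 t1 fgq'.
have fgq x : t * f x + (1 - t) * g x <= q x.
  exact: le_trans (fgq' x) (face_le qq' x).
apply: (face_extremal qq' fL gL _ _ t0 t1 fgq').
  exact: (face_extremal pq fL gL fp gp t0 t1 fgq).
apply: (face_extremal pq gL fL gp fp (t := 1 - t)).
- by rewrite subr_gt0.
- by rewrite ltrBlDr ltrDl.
- by move=> x; rewrite subKr addrC.
Qed.

(* The face on which the evaluation at [y] attains its maximum [p y]. *)
Definition face p y :=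
  pointwise_inf [set g | exists2 t : R, 0 <= t &
    g = fun x => p (x + t *: y) - t * p y].

(** This makes the infimum in [face] a genuine one. It comes from [t * p y <= p (t *: y)] and
    subadditivity at the sum of [x + t *: y] and [- x]. *)
Lemma face_lower p y g x : sublinear p ->
  (exists2 t : R, 0 <= t & g = fun x => p (x + t *: y) - t * p y) ->
  - p (- x) <= g x.
Proof.
move=> pS [t t0 ->]; case: (ltgtP t 0) t0 => // [{}t0|->] _; last first.
  by rewrite scale0r addr0 mul0r subr0 sublinear_ge.
have : t * p y <= p (t *: y).
  have ti : 0 < t^-1 by rewrite invr_gt0.
  have := sublinearZ pS (t *: y) ti; rewrite scalerA mulVf ?gt_eqF// scale1r.
  by rewrite [X in _ <= X]mulrC ler_pdivlMr// mulrC.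
have := sublinearD pS (x + t *: y) (- x).
by rewrite [x + _]addrC addrK; lra.
Qed.

Lemma face_upper p y t x : sublinear p -> 0 <= t ->
  face p y x <= p (x + t *: y) - t * p y.
Proof.
move=> pS t0; pose b z := - p (- z).
apply: (@pointwise_inf_le _ b (fun x => p (x + t *: y) - t * p y)).
  by move=> h z; exact: face_lower.
by exists t.
Qed.

Lemma face_of_face p y : sublinear p -> face_of p (face p y).
Proof.
move=> pS; split.
- apply: (@sublinear_pointwise_inf _ (fun x => - p (- x))).
  + by exists (fun x => p (x + 0 *: y) - 0 * p y), 0.
  + by move=> g x; exact: face_lower.
  + move=> _ _ [t t0 ->] [s s0 ->].
    exists (fun x => p (x + (t + s) *: y) - (t + s) * p y).
      by exists (t + s) => //; rewrite addr_ge0.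
    move=> u v /=; have := sublinearD pS (u + t *: y) (v + s *: y).
    by rewrite addrACA -scalerDl; lra.
  + move=> _ r [t t0 ->] r0.
    exists (fun x => p (x + (r * t) *: y) - (r * t) * p y).
      by exists (r * t) => //; rewrite mulr_ge0// ltW.
    move=> u /=; have := sublinearZ pS (u + t *: y) r0.
    by rewrite scalerDr scalerA mulrBr -mulrA; lra.
- move=> x; have := face_upper y x pS (lexx 0).
  by rewrite scale0r addr0 mul0r subr0.
- move=> f g t fL gL fp gp t0 t1 fg x.
  (* At [- y] the hypothesis bounds [t * f y + (1 - t) * g y] below by [p y]; since [f y] and [g y]
     are at most [p y], equality is forced. *)
  have fy : f y = p y.
    apply/eqP; rewrite eq_le fp/=.
    have := face_upper y (- y) pS (ler01).
    rewrite scale1r mul1r addNr sublinear0// sub0r.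
    have := fg (- y); rewrite (scalar_funN _ fL) (scalar_funN _ gL).
    have := gp y => gy fgy /(le_trans fgy) py.
    rewrite -subr_ge0 -(pmulr_rge0 _ t0).
    have : 0 <= (1 - t) * (p y - g y) by rewrite mulr_ge0// subr_ge0// ltW.
    lra.
  rewrite /face; apply: le_pointwise_inf.
    by exists (fun x => p (x + 0 *: y) - 0 * p y), 0.
  move=> _ [s s0 ->].
  by rewrite -fy -(scalar_funZ _ _ fL) lerBrDr -(scalar_funD _ _ fL).
Qed.

Lemma face_ge p y f : sublinear p -> scalar f ->
  (forall x, f x <= face p y x) -> p y <= f y.
Proof.
move=> pS fL /(_ (- y)) fy; have := face_upper y (- y) pS ler01.
rewrite scale1r mul1r addNr sublinear0// sub0r => /(le_trans fy).
by rewrite (scalar_funN _ fL) lerN2.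
Qed.

Lemma le_face p y f : scalar f -> (forall x, f x <= p x) -> f y = p y ->
  forall x, f x <= face p y x.
Proof.
move=> fL fp fy x.
rewrite /face; apply: le_pointwise_inf.
  by exists (fun x => p (x + 0 *: y) - 0 * p y), 0.
move=> _ [s s0 ->].
by rewrite -fy -(scalar_funZ _ _ fL) lerBrDr -(scalar_funD _ _ fL).
Qed.

(* Hahn-Banach and Krein-Milman at once: a minimal face [m] is a single point,
   since [face m y = m] for all [y] makes it additive. *)
Lemma face_of_scalar p q : face_of p q ->
  exists f, [/\ scalar f, forall x, f x <= q x & face_of p f].
Proof.
move=> pq.
pose P f := face_of p f /\ forall x, f x <= q x.
pose T := {f : V -> R | P f}.
(* The order is reversed, so that a maximal element for [le] is a minimal functional. *)
pose le (a b : T) := `[< forall x, sval b x <= sval a x >].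
have [||||[m [pm mq]] mmin] := @Zorn T le.
- by move=> a; apply/asboolP.
- move=> a b c /asboolP ab /asboolP bc; apply/asboolP => x.
  exact: le_trans (bc x) (ab x).
- move=> [a ?] [b ?] /asboolP/= ab /asboolP/= ba; apply: eq_exist.
  by apply/funext => x; apply/eqP; rewrite eq_le ab ba.
- move=> A Atot; have [[a0 Aa0]|A0] := pselect (A !=set0); last first.
    have qq : P q by [].
    by exists (exist P q qq) => s As; exfalso; apply: A0; exists s.
  pose G : set (V -> R) := [set sval a | a in A].
  have Gb g x : G g -> - p (- x) <= g x.
    move=> [[a [pa aq]] Aa <-] /=.
    have := sublinear_ge x (face_sublinear pa); apply: le_trans.
    by rewrite lerN2; exact: face_le pa _.
  have G0 : G !=set0 by exists (sval a0), a0.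
  have GS : sublinear (pointwise_inf G).
    apply: (sublinear_pointwise_inf G0 Gb).
      move=> _ _ [a Aa <-] [b Ab <-].
      have [pa _] := svalP a; have [pb _] := svalP b.
      have [/asboolP ab|/asboolP ba] := Atot _ _ Aa Ab.
        exists (sval b); first by exists b.
        move=> x y; have := sublinearD (face_sublinear pb) x y.
        by have := ab x; lra.
      exists (sval a); first by exists a.
      move=> x y; have := sublinearD (face_sublinear pa) x y.
      by have := ba y; lra.
    move=> _ r [a Aa <-] r0; exists (sval a); first by exists a.
    have [pa _] := svalP a; move=> x.
    exact: (sublinearZ (face_sublinear pa) x r0).
  have Gq x : pointwise_inf G x <= q x.
    have [_ aq] := svalP a0; apply: le_trans (aq x).
    by apply: (pointwise_inf_le _ Gb); exists a0.
  have Gp : face_of p (pointwise_inf G).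
    split => // [x|f g t fL gL fp gp t0 t1 fg x].
      exact: le_trans (Gq x) (face_le pq x).
    apply: le_pointwise_inf => // _ [a Aa <-]; have [pa _] := svalP a.
    apply: (face_extremal pa fL gL fp gp t0 t1) => y; apply: le_trans (fg y) _.
    by apply: (pointwise_inf_le _ Gb); exists a.
  exists (exist P _ (conj Gp Gq)) => s As; apply/asboolP => x /=.
  by apply: (pointwise_inf_le _ Gb); exists s.
have mS := face_sublinear pm.
exists m; split => //; apply: sublinear_additive_scalar => // x y.
have my := face_of_face y mS.
have fq z : face m y z <= q z by exact: le_trans (face_le my z) (mq z).
have mm : face m y = m.
  have /(_ _)/(congr1 sval) := mmin (exist P _ (conj (face_trans pm my) fq)).
  by apply; apply/asboolP => z /=; exact: face_le my z.
(* With coefficient 1, [face_upper] reads [m x <= m (x + y) - m y], the missing half of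
   additivity. *)
by have := face_upper y x mS ler01; rewrite mm scale1r mul1r; lra.
Qed.

End Sublinear.

(** * Linear functionals below a sum or a maximum of two sublinear ones *)

Section Decomposition.
Context {R : realType} {V : lmodType R}.
Implicit Types (p q f g l : V -> R) (x y : V).

(** Separation in the plane: the pairs that dominate some [(p1 x, p2 x)] form a convex cone missing
    the open negative quadrant, and [(t, 1 - t)] is the normal of a separating line. *)
Lemma sublinear_minimax p1 p2 : sublinear p1 -> sublinear p2 ->
  (forall x, 0 <= p1 x \/ 0 <= p2 x) ->
  exists t : R, [/\ 0 <= t, t <= 1 & forall x, 0 <= t * p1 x + (1 - t) * p2 x].
Proof.
move=> p1S p2S p12.
(* the lower bounds imposed on [t] by the points where [p2] is negative; the
   points where [p1] is negative impose upper bounds, compatible by [cross] *)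
pose E := [set s : R | s = 0 \/
  exists2 y, p2 y < 0 & s = - p2 y / (p1 y - p2 y)].
have p1_ge0 y : p2 y < 0 -> 0 <= p1 y by case: (p12 y) => //; lra.
have E1 s : E s -> s <= 1.
  case=> [->//|[y y0 ->]]; have y1 := p1_ge0 y y0.
  by rewrite ler_pdivrMr; lra.
have E0 : E 0 by left.
have Eub : has_ubound E by exists 1.
have E_nonempty : E !=set0 by exists 0.
have cross x y : p1 x < 0 -> p2 y < 0 -> p2 y * p1 x <= p2 x * p1 y.
  move=> x0 y0; rewrite leNgt; apply/negP => xy.
  have x1 : 0 <= p2 x by case: (p12 x) => //; lra.
  have y1 := p1_ge0 y y0.
  (* At the combination of [x] and [y] below, this [e] bounds [p1] by [e * p1 x] and [p2] by [- e],
     both negative, against [p12]. The [+ 1] keeps the denominator positive when [p2 x = 0]. *)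
  pose e := (p2 y * p1 x - p2 x * p1 y) / (p2 x + 1).
  have e0 : 0 < e by rewrite divr_gt0; lra.
  have ee : e * p2 x + e = p2 y * p1 x - p2 x * p1 y by rewrite /e; field; lra.
  have a0 : 0 < p1 y + e by lra.
  have b0 : 0 < - p1 x by lra.
  have h1 := sublinearD p1S ((p1 y + e) *: x) ((- p1 x) *: y).
  have h2 := sublinearD p2S ((p1 y + e) *: x) ((- p1 x) *: y).
  have := sublinearZ p1S x a0; have := sublinearZ p1S y b0.
  have := sublinearZ p2S x a0; have := sublinearZ p2S y b0.
  have ex : e * p1 x < 0 by rewrite pmulr_rlt0.
  by case: (p12 ((p1 y + e) *: x + (- p1 x) *: y)); lra.
have t0 : 0 <= sup E by exact: ub_le_sup.
have t1 : sup E <= 1 by apply: ge_sup.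
exists (sup E); split=> // x.
have [x2|x2] := ltP (p2 x) 0.
  have x1 := p1_ge0 x x2.
  have : - p2 x / (p1 x - p2 x) <= sup E.
    by apply: ub_le_sup => //; right; exists x.
  by rewrite ler_pdivrMr; lra.
have [x1|x1] := ltP (p1 x) 0; last by rewrite addr_ge0// mulr_ge0//; lra.
have : sup E <= p2 x / (p2 x - p1 x).
  apply: ge_sup => // s [->|[y y2 ->]]; first by rewrite divr_ge0//; lra.
  have y1 := p1_ge0 y y2.
  rewrite ler_pdivrMr; last lra.
  rewrite mulrAC ler_pdivlMr; last lra.
  by have := cross x y x1 y2; lra.
by rewrite ler_pdivlMr; lra.
Qed.

(** The two conditions on [f] say that it lies below [p1] and below [y |-> p2 (- y) + l y].
    Hahn-Banach applies to the infimal convolution of these two, which is bounded below by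
    [l - p2]. *)
Lemma scalar_le_sum p1 p2 l : sublinear p1 -> sublinear p2 -> scalar l ->
  (forall x, l x <= p1 x + p2 x) ->
  exists f, [/\ scalar f, forall x, f x <= p1 x & forall x, l x - f x <= p2 x].
Proof.
move=> p1S p2S lL lp.
pose G := [set g | exists y, g = fun x => p1 (x - y) + p2 (- y) + l y].
have Gb g x : G g -> l x - p2 x <= g x.
  move=> [y ->]; have := lp (x - y); have := sublinearD p2S x (- y).
  by rewrite (scalar_funD _ _ lL) (scalar_funN _ lL); lra.
have qS : sublinear (pointwise_inf G).
  apply: (sublinear_pointwise_inf _ Gb).
  - by exists (fun x => p1 (x - 0) + p2 (- 0) + l 0), 0.
  - move=> _ _ [y ->] [z ->].
    exists (fun x => p1 (x - (y + z)) + p2 (- (y + z)) + l (y + z)).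
      by exists (y + z).
    move=> u v; rewrite opprD addrACA (scalar_funD _ _ lL).
    have := sublinearD p1S (u - y) (v - z).
    by have := sublinearD p2S (- y) (- z); lra.
  - move=> _ r [y ->] r0.
    exists (fun x => p1 (x - r *: y) + p2 (- (r *: y)) + l (r *: y)).
      by exists (r *: y).
    move=> u; rewrite -scalerN -scalerDr (scalar_funZ _ _ lL).
    have := sublinearZ p1S (u - y) r0; have := sublinearZ p2S (- y) r0.
    lra.
have [f [fL fq _]] := face_of_scalar (face_refl qS).
have f_le x y : f x <= p1 (x - y) + p2 (- y) + l y.
  apply: le_trans (fq x) _.
  pose g x := p1 (x - y) + p2 (- y) + l y.
  by apply: (pointwise_inf_le (g := g) _ Gb); exists y.
exists f; split=> // x.
  by have := f_le x 0; rewrite oppr0 addr0 (sublinear0 p2S) (scalar_fun0 lL);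
    lra.
have := f_le (- x) (- x); rewrite subrr opprK (sublinear0 p1S).
by rewrite (scalar_funN _ lL) (scalar_funN _ fL); lra.
Qed.

(** [sublinear_minimax] for [p1 - l] and [p2 - l] gives [l <= t * p1 + (1 - t) * p2]. The values 0
    and 1 of [t] give the first two cases; otherwise [scalar_le_sum] splits [l]. *)
Lemma scalar_le_max p1 p2 l : sublinear p1 -> sublinear p2 -> scalar l ->
  (forall x, l x <= Num.max (p1 x) (p2 x)) ->
  [\/ forall x, l x <= p1 x, forall x, l x <= p2 x |
  exists f g (t : R), [/\ scalar f /\ scalar g, forall x, f x <= p1 x,
    forall x, g x <= p2 x, 0 < t < 1 & forall x,
      l x = t * f x + (1 - t) * g x]].
Proof.
move=> p1S p2S lL lp.
have subS p : sublinear p -> sublinear (fun x => p x - l x).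
  move=> pS; split=> [x y|r x r0].
    by have := sublinearD pS x y; rewrite (scalar_funD _ _ lL); lra.
  by have := sublinearZ pS x r0; rewrite (scalar_funZ _ _ lL); lra.
have [|t [t0 t1 tp]] := sublinear_minimax (subS _ p1S) (subS _ p2S).
  by move=> x; have := lp x; rewrite le_max => /orP[]; [left|right]; lra.
have {}tp x : l x <= t * p1 x + (1 - t) * p2 x by have := tp x; lra.
move: t0; rewrite le_eqVlt => /predU1P[t0|t0].
  by constructor 2 => x; have := tp x; rewrite -t0; lra.
move: t1; rewrite le_eqVlt => /predU1P[t1|t1].
  by constructor 1 => x; have := tp x; rewrite t1; lra.
have s0 : 0 < 1 - t by lra.
have mulS r p : 0 < r -> sublinear p -> sublinear (fun x => r * p x).
  move=> r0 pS; split=> [x y|s x s0'].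
    by rewrite -mulrDr ler_pM2l//; exact: sublinearD.
  by rewrite mulrCA ler_pM2l//; exact: sublinearZ.
have [f [fL fp lfp]] := scalar_le_sum (mulS _ _ t0 p1S) (mulS _ _ s0 p2S) lL tp.
constructor 3; exists (fun x => f x / t), (fun x => (l x - f x) / (1 - t)), t.
split; rewrite ?t0 ?t1//.
- by split=> a x y /=; rewrite fL ?lL /=; field; lra.
- by move=> x; rewrite ler_pdivrMr// mulrC.
- by move=> x; rewrite ler_pdivrMr// mulrC.
- by move=> x; field; lra.
Qed.

End Decomposition.

(** * Milman's theorem for a family of functionals *)

Section Milman.
Context {R : realType} {V : lmodType R} {I : Type} (ev : I -> V -> R).
Implicit Types (A : set I) (f : V -> R).

(* [carries A f] says that [f] lies below the supremum of the [ev i], [i] in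
   [A], i.e., in the weak* closed convex hull of these functionals. *)
Definition carries A f :=
  forall x c, (forall i, A i -> ev i x <= c) -> f x <= c.

Lemma carriesS A B f : A `<=` B -> carries A f -> carries B f.
Proof. by move=> AB Af x c Bc; apply: Af => i /AB; exact: Bc. Qed.

Lemma carries0 f : ~ carries set0 f.
Proof.
by move=> /(_ 0 (f 0 - 1)) f0; have := f0 (fun _ => False_ind _); lra.
Qed.

Lemma carries_sup A f : A !=set0 ->
  (forall x, has_ubound [set ev i x | i in A]) ->
  carries A f <-> forall x, f x <= sup [set ev i x | i in A].
Proof.
move=> [i Ai] Aub; split=> [Af x|fs x c Ac].
  by apply: Af => j Aj; apply: ub_le_sup => //; exists j.
apply: le_trans (fs x) _; apply: ge_sup; first by exists (ev i x), i.
by move=> _ [j Aj <-]; exact: Ac.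
Qed.

Context (N : V -> R) (M : set I).
Hypothesis ev_scalar : forall i, M i -> scalar (ev i).
Hypothesis ev_le : forall i x, M i -> ev i x <= N x.

Lemma ev_ubound A x : A `<=` M -> has_ubound [set ev i x | i in A].
Proof. by move=> AM; exists (N x) => _ [i Ai <-]; apply: ev_le; exact: AM. Qed.

Lemma sublinear_sup A : A `<=` M -> A !=set0 ->
  sublinear (fun x => sup [set ev i x | i in A]).
Proof.
move=> AM A0.
have le_sup i x : A i -> ev i x <= sup [set ev i x | i in A].
  by move=> Ai; apply: ub_le_sup; [exact: ev_ubound|exists i].
have im0 x : [set ev i x | i in A] !=set0 by case: A0 => i; exists (ev i x), i.
split=> [x y|r x r0]; apply: ge_sup => // _ [i Ai <-];
    have iL := ev_scalar (AM i Ai).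
  by rewrite scalar_funD// lerD// le_sup.
by rewrite scalar_funZ// ler_pM2l// le_sup.
Qed.

(* An extreme point in the convex hull of two convex sets is in one of them. *)
Lemma carriesU A B f : A `<=` M -> B `<=` M -> scalar f -> face_of N f ->
  carries (A `|` B) f -> carries A f \/ carries B f.
Proof.
move=> AM BM fL fN fAB.
have [A0|/set0P/negP/negPn/eqP A0] := pselect (A !=set0); last first.
  by right; apply: carriesS fAB; rewrite A0 set0U.
have [B0|/set0P/negP/negPn/eqP B0] := pselect (B !=set0); last first.
  by left; apply: carriesS fAB; rewrite B0 setU0.
have Aub x := ev_ubound x AM; have Bub x := ev_ubound x BM.
have sup_le C x : C `<=` M -> C !=set0 -> sup [set ev i x | i in C] <= N x.
  move=> CM [i Ci]; apply: ge_sup; first by exists (ev i x), i.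
  by move=> _ [j Cj <-]; apply: ev_le; exact: CM.
have fM x :
    f x <= Num.max (sup [set ev i x | i in A]) (sup [set ev i x | i in B]).
  apply: fAB => i [Ai|Bi]; rewrite le_max; apply/orP; [left|right];
    by apply: ub_le_sup => //; exists i.
have [fA|fB|] := scalar_le_max (sublinear_sup AM A0) (sublinear_sup BM B0)
  fL fM.
- by left; apply/carries_sup.
- by right; apply/carries_sup.
move=> [g [h [t [[gL hL] gA hB /andP[t0 t1] fgh]]]]; left;
  apply/carries_sup => // x.
(* Extremality of [f] below [N] gives [g <= f], hence equality by linearity. *)
suff <- : g = f by exact: gA.
apply: scalar_le_eq => //; apply: (face_extremal fN gL hL _ _ t0 t1).
- by move=> y; exact: le_trans (gA y) (sup_le _ _ AM A0).
- by move=> y; exact: le_trans (hB y) (sup_le _ _ BM B0).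
- by move=> y; rewrite fgh.
Qed.

(* Milman's theorem. By [carriesU] the sets whose complement in [M] does not
   carry [f] form a filter. *)
Lemma milman f : scalar f -> face_of N f -> carries M f ->
  exists F : set_system I, [/\ ProperFilter F, F M &
    forall x, ev i x @[i --> F] --> f x].
Proof.
move=> fL fN fM.
pose F : set_system I := [set S | ~ carries (M `\` S) f].
have FF : Filter F.
  split.
  - by rewrite /F /= setDT; exact: carries0.
  - move=> P Q FP FQ; rewrite /F /= setDIr.
    by move=> /(carriesU (@subDsetl _ _ _) (@subDsetl _ _ _) fL fN)[].
  - move=> P Q PQ FP FQ; apply: FP; apply: carriesS FQ.
    by move=> i [Mi nQ]; split=> // /PQ.
have FM : F M by rewrite /F /= setDv; exact: carries0.
(* Otherwise [f] would be carried by indices with [ev i x <= f x - e], so that [f x <= f x - e]. The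
   upper estimate will come from the same bound at [- x]. *)
have F_gt x e : 0 < e -> \forall i \near F, f x - e < ev i x.
  move=> e0 /(_ x (f x - e)) fe.
  suff : f x <= f x - e by lra.
  by apply: fe => i [_ /negP]; rewrite -leNgt.
exists F; split => // [|x].
  by split=> //; rewrite /F /= setD0; exact.
apply/cvgrPdist_lt => e e0.
have h1 := F_gt x e e0; have h2 := F_gt (- x) e e0.
near=> i; have iM : M i by near: i.
have l1 : f x - e < ev i x by near: i.
have l2 : f (- x) - e < ev i (- x) by near: i.
move: l2; rewrite (scalar_funN _ fL) (scalar_funN _ (ev_scalar iM)) => l2.
by rewrite ltr_norml; apply/andP; split; lra.
Unshelve. all: by end_near. Qed.

End Milman.

(** * Real and complex scalars under one interface *)

Record real_part (R : realType) (K : numFieldType) := RealPart {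
  emb : {rmorphism R -> K};
  re : K -> R;
  (* [0] for [K = R] and the imaginary unit for [K = R[i]] *)
  iu : K;
  ler_emb : {mono emb : r s / r <= s};
  reD : forall z z', re (z + z') = re z + re z';
  re_embM : forall r z, re (emb r * z) = r * re z;
  re_le_norm : forall z, emb (re z) <= `|z|;
  emb_re_ge0 : forall z, 0 <= z -> emb (re z) = z;
  reE : forall z, z = emb (re z) - iu * emb (re (iu * z));
  iu_sqr : iu = 0 \/ iu * iu = -1 }.

Section RealPartTheory.
Context {R : realType} {K : numFieldType} (s : real_part R K).
Implicit Types (z : K) (r : R).

Lemma ltr_emb : {mono emb s : r t / r < t}.
Proof. exact: leW_mono (ler_emb s). Qed.

Lemma re0 : re s 0 = 0.
Proof. by have := reD s 0 0; rewrite addr0; lra. Qed.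

Lemma reN z : re s (- z) = - re s z.
Proof. by have := reD s z (- z); rewrite subrr re0; lra. Qed.

Lemma ge0_reE z : 0 <= z -> z = emb s (re s z).
Proof. by move/emb_re_ge0. Qed.

Lemma emb_re_norm (Z : normedZmodType K) (x : Z) : emb s (re s `|x|) = `|x|.
Proof. exact: emb_re_ge0. Qed.

Lemma re_emb r : re s (emb s r) = r.
Proof.
have e1 : re s 1 = 1.
  by apply: (fmorph_inj (emb s)); rewrite -ge0_reE// rmorph1.
by rewrite -[emb s r]mulr1 re_embM e1 mulr1.
Qed.

Lemma re_iu : re s (iu s) = 0.
Proof.
case: (iu_sqr s) => [->|i2]; first exact: re0.
apply: (fmorph_inj (emb s)); rewrite rmorph0.
have := reE s (iu s); rewrite i2 reN -(rmorph1 (emb s)) re_emb rmorphN1 mulrN1.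
by rewrite opprK => h; apply: (addIr (iu s)); rewrite add0r.
Qed.

Lemma norm_iu_le1 : `|iu s| <= 1.
Proof.
case: (iu_sqr s) => [->|i2]; first by rewrite normr0.
have : `|iu s| ^+ 2 = 1 by rewrite -normrX expr2 i2 normrN1.
by move/eqP; rewrite sqrf_eq1 => /orP[/eqP->//|/eqP ->];
  rewrite (le_trans _ ler01)// lerN10.
Qed.

(** Reduces smallness in [K] to smallness of two real numbers, by [reE] and [norm_iu_le1]. *)
Lemma norm_le_re z : `|z| <= emb s (`|re s z| + `|re s (iu s * z)|).
Proof.
have emb_norm r : `|emb s r| = emb s `|r|.
  have [r0|/ltW r0] := leP 0 r.
    by rewrite [`|r|]ger0_norm// ger0_norm// -(rmorph0 (emb s)) ler_emb.
  rewrite [`|r|]ler0_norm// rmorphN/= ler0_norm//.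
  by rewrite -(rmorph0 (emb s)) ler_emb.
rewrite rmorphD/= [in X in X <= _](reE s z) (le_trans (ler_normB _ _))//.
by rewrite normrM !emb_norm lerD2l ler_piMl ?norm_iu_le1// -emb_norm.
Qed.

Lemma unit_rotation z : exists2 u : K, `|u| = 1 & u * z = `|z|.
Proof.
have [->|z0] := eqVneq z 0; first by exists 1; rewrite ?normr1// mulr0 normr0.
exists (`|z| / z); last by rewrite divfK.
by rewrite normrM normfV normr_id divff// normr_eq0.
Qed.

(** In the partial order of [K], [supremum] takes a default value unless a least upper bound exists.
    Here the real one is transported by [emb]: the elements of [A], and hence its upper bounds, are
    nonnegative and so come from reals. *)
Lemma supremum_nonneg (A : set K) : A !=set0 -> (forall z, A z -> 0 <= z) ->
  has_ubound A -> supremums A (supremum 0 A).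
Proof.
move=> [z0 Az0] A0 [b Ab].
have reA z c : A z -> z <= c -> re s z <= re s c.
  move=> Az zc; have z0' := A0 _ Az.
  by rewrite -(ler_emb s) -!ge0_reE// (le_trans z0').
have hs : has_sup [set re s z | z in A].
  split; first by exists (re s z0), z0.
  by exists (re s b) => _ [z Az <-]; apply: reA => //; exact: Ab.
have sA : supremums A (emb s (sup [set re s z | z in A])).
  split=> [z Az|c cA].
    rewrite (ge0_reE (A0 _ Az)) ler_emb; apply: ub_le_sup; first by case: hs.
    by exists z.
  have c0 : 0 <= c by rewrite (le_trans (A0 _ Az0))//; exact: cA.
  rewrite (ge0_reE c0) ler_emb; apply: ge_sup; first by case: hs.
  by move=> _ [z Az <-]; apply: reA => //; exact: cA.
rewrite /supremum ifF; last by apply/eqP => A_eq0; rewrite A_eq0 in Az0.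
by case: xgetP => [y -> //|/(_ _ sA)].
Qed.

(** Keeping [s] in the type lets the [R]-module structure given by [emb s] be inferred from it. *)
Definition realified of real_part R K := fun V : lmodType K => V : Type.

Section Realified.
Context (V : lmodType K).

HB.instance Definition _ := GRing.Zmodule.on (realified s V).

Let scale r (x : realified s V) : realified s V := emb s r *: (x : V).

Lemma realified_scaleA a b x : scale a (scale b x) = scale (a * b) x.
Proof. by rewrite /scale scalerA rmorphM. Qed.

Lemma realified_scale1 x : scale 1 x = x.
Proof. by rewrite /scale rmorph1 scale1r. Qed.

Lemma realified_scaleDr : right_distributive scale +%R.
Proof. by move=> r x y; rewrite /scale scalerDr. Qed.

Lemma realified_scaleDl x : {morph scale^~ x : a b / a + b}.
Proof. by move=> a b; rewrite /scale rmorphD scalerDl. Qed.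

HB.instance Definition _ := GRing.Zmodule_isLmodule.Build R (realified s V)
  realified_scaleA realified_scale1 realified_scaleDr realified_scaleDl.

Lemma realified_scaleE r (x : realified s V) : r *: x = emb s r *: (x : V).
Proof. by []. Qed.

End Realified.

Lemma scalar_re (V : lmodType K) (f : V -> K) : scalar f ->
  scalar (fun x : realified s V => re s (f x)).
Proof.
by move=> fL r x y /=; rewrite realified_scaleE fL /= reD re_embM.
Qed.

Lemma scalar_re_inj (V : lmodType K) (f g : V -> K) : scalar f -> scalar g ->
  (forall x, re s (f x) = re s (g x)) -> f = g.
Proof.
move=> fL gL fg; apply/funext => x.
have fi := fL (iu s) x 0; have gi := gL (iu s) x 0.
have f0 : f 0 = 0 by have := fL (-1) 0 0; rewrite scaler0 addr0 /= mulN1r addNr.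
have g0 : g 0 = 0 by have := gL (-1) 0 0; rewrite scaler0 addr0 /= mulN1r addNr.
rewrite !addr0 f0 addr0 /= in fi; rewrite !addr0 g0 addr0 /= in gi.
by rewrite (reE s (f x)) (reE s (g x)) fg -fi -gi fg.
Qed.

(** The usual [f x - i f (i x)], the complex functional with real part [f]; for [iu s = 0] it is [f]
    followed by [emb s]. *)
Definition complexify (V : lmodType K) (f : V -> R) x :=
  emb s (f x) - iu s * emb s (f (iu s *: x)).

Lemma re_complexify (V : lmodType K) (f : V -> R) x :
  re s (complexify f x) = f x.
Proof. by rewrite reD reN mulrC re_embM re_iu mulr0 subr0 re_emb. Qed.

Lemma scalar_complexify (V : lmodType K) (f : V -> R) :
  scalar (f : realified s V -> R) -> scalar (complexify f).
Proof.
move=> fL c x y.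
have fD u v : f (u + v) = f u + f v by exact: (scalar_funD _ _ fL).
have fZ r u : f (emb s r *: u) = r * f u by exact: (scalar_funZ _ _ fL).
have fN u : f (- u) = - f u by exact: (scalar_funN _ fL).
rewrite /complexify !scalerDr !fD !rmorphD/=.
suff : complexify f (c *: x) = c * complexify f x.
  by rewrite /complexify => h; rewrite mulrDr opprD addrACA h.
(* [b] is minus the imaginary part of [c] over [R[i]], and 0 over [R]. *)
pose a := re s c; pose b := re s (iu s * c).
have cE : c = emb s a - iu s * emb s b by exact: reE.
have cx u : c *: u = emb s a *: u - emb s b *: (iu s *: u).
  by rewrite cE scalerBl mulrC scalerA.
have icx : iu s *: (c *: x) = c *: (iu s *: x) by rewrite !scalerA mulrC.
rewrite /complexify icx !cx !(fD, fN, fZ) !(rmorphD, rmorphN, rmorphM)/= cE.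
case: (iu_sqr s) => [->|i2].
  by rewrite !scale0r (scalar_fun0 fL) rmorph0; ring.
have -> : iu s *: (iu s *: x) = - x by rewrite scalerA i2 scaleN1r.
by rewrite fN rmorphN/=; ring: i2.
Qed.

End RealPartTheory.

(** * The dual ball and its extreme points through real parts *)

Section DualBall.
Context {R : realType} {K : numFieldType} (s : real_part R K).
Context (Z : normedModType K).
Implicit Types (f : dual Z).

Let renorm (x : realified s Z) : R := re s `|x : Z|.

Lemma sublinear_renorm : sublinear renorm.
Proof.
split=> [x y|r x r0].
  by rewrite /renorm -reD -(ler_emb s) -!ge0_reE ?addr_ge0// ler_normD.
rewrite /renorm realified_scaleE normrZ ger0_norm ?re_embM//.
by rewrite -(rmorph0 (emb s)) ler_emb ltW.
Qed.

Lemma scalar_dual f : scalar (f : Z -> K).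
Proof. exact: bop_linear f. Qed.

(** A unit scalar [u] turns [f (u *: x)] into the modulus of [f x] without changing the norm of [x],
    so bounding real parts everywhere bounds moduli. *)
Lemma norm_le_renormP (f : Z -> K) : scalar f ->
  (forall x, `|f x| <= `|x|) <-> (forall x, re s (f x) <= renorm x).
Proof.
move=> fL; split=> h x.
  by rewrite -(ler_emb s) /renorm emb_re_norm (le_trans (re_le_norm _ _)).
have f0 : f 0 = 0 by have := fL (-1) 0 0; rewrite scaler0 addr0 /= mulN1r addNr.
have [u u1 ufx] := unit_rotation (f x).
have fux : f (u *: x) = `|f x|.
  by have := fL u x 0; rewrite !addr0 f0 addr0 /= ufx.
have := h (u *: x); rewrite -(ler_emb s) /renorm emb_re_norm normrZ u1 mul1r.
by rewrite fux emb_re_norm.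
Qed.

Lemma dual_norm_supremums f :
  supremums [set `|f x| | x in [set x : Z | `|x| <= 1]] (dual_norm f).
Proof.
apply: (supremum_nonneg s).
- by exists `|f 0|, 0 => //=; rewrite normr0.
- by move=> _ [x _ <-].
have /asboolP[_ [M fM]] := bop_funP f.
exists `|M| => _ [x x1 <-].
have : `|f x| <= `|M| * `|x|.
  have := fM x => fx; rewrite (le_trans fx)// -[`|x| in leRHS]normr_id -normrM.
  by rewrite ger0_norm// (le_trans _ fx).
by move=> /le_trans; apply; rewrite ler_piMr.
Qed.

Lemma dual_ballP f : dual_ball f <-> forall x, `|f x| <= `|x|.
Proof.
have [ub lub] := dual_norm_supremums f; split=> [f1 x|f1]; last first.
  by apply: lub => _ [x x1 <-]; exact: le_trans (f1 x) x1.
have [->|x0] := eqVneq x 0; first by rewrite raddf0 !normr0.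
have nx : `|x| != 0 by rewrite normr_eq0.
have /ub : [set `|f x| | x in [set x : Z | `|x| <= 1]] `|f (`|x|^-1 *: x)|.
  by exists (`|x|^-1 *: x) => //=; rewrite normrZ normfV normr_id mulVf.
move=> /le_trans/(_ f1); rewrite linearZ/= normrM normfV normr_id.
by rewrite mulrC ler_pdivrMr ?mul1r// lt_def nx /=.
Qed.

Lemma dual_ball_reP f : dual_ball f <-> forall x, re s (f x) <= renorm x.
Proof.
by split=> [/dual_ballP/(norm_le_renormP (scalar_dual f))//|];
  move=> /(norm_le_renormP (scalar_dual f))/dual_ballP.
Qed.

Lemma dual_sphereP f x : dual_ball f -> `|x| = 1 -> `|f x| = 1 -> dual_sphere f.
Proof.
move=> f1 x1 fx; apply/eqP; rewrite eq_le f1/= -fx.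
by have [ub _] := dual_norm_supremums f; apply: ub; exists x; rewrite //= x1.
Qed.

(** With [dual_re_inj] and [dual_ball_reP], this identifies the dual ball with the real-linear
    functionals below [renorm]. *)
Lemma dual_of_re (g : Z -> R) : scalar (g : realified s Z -> R) ->
  (forall x, g x <= renorm x) ->
  exists2 f : dual Z, dual_ball f & forall x, re s (f x) = g x.
Proof.
move=> gL gN; have fL := scalar_complexify gL.
have fN x : `|complexify s g x| <= `|x|.
  by move: x; apply/norm_le_renormP => // x; rewrite re_complexify.
have fB : (complexify s g : Z -> K^o) \in @bounded_linear K Z K^o.
  by apply/asboolP; split=> //; exists 1 => x; rewrite mul1r.
exists (Bop fB) => [|x]; first exact/dual_ballP.
by rewrite /= re_complexify.
Qed.

Lemma dual_re_inj f f' : (forall x, re s (f x) = re s (f' x)) -> f = f'.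
Proof.
by move=> h; apply/val_inj/(scalar_re_inj (s := s) (scalar_dual f)
  (scalar_dual f') h).
Qed.

(** An inequality between linear functionals is an equality, so the condition in [face_of] becomes
    extremality once real functionals are lifted by [dual_of_re]. *)
Lemma extreme_dual_ballP f : extreme_points (@dual_ball K Z) f <->
  face_of renorm (fun x : realified s Z => re s (f x)).
Proof.
have reL (h : dual Z) : scalar (fun x : realified s Z => re s (h x)).
  exact: scalar_re (scalar_dual h).
split=> [[f1 fE]|fF]; split.
- exact: sublinear_scalar.
- exact/dual_ball_reP.
- move=> g h t gL hL gN hN t0 t1 gh x.
  have [g' g'1 g'E] := dual_of_re gL gN; have [h' h'1 h'E] := dual_of_re hL hN.
  suff /fE[] : f = emb s t *: g' + (1 - emb s t) *: h'.
  + by [].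
  + by [].
  + by rewrite -(rmorph0 (emb s)) ltr_emb.
  + by rewrite -(rmorph1 (emb s)) ltr_emb.
  + by move=> <- _; rewrite g'E.
  apply: dual_re_inj => y.
  transitivity (t * g y + (1 - t) * h y); last first.
    rewrite -g'E -h'E -!(re_embM s) -reD rmorphB rmorph1; congr (re s _).
  have := @scalar_le_eq R (realified s Z) (fun y => t * g y + (1 - t) * h y)
    (fun y => re s (f y)).
  move=> /(_ _ (reL f) gh)/(congr1 (fun k => k y))/= ->//.
  by move=> r u v /=; rewrite gL hL /=; ring.
- by apply/dual_ball_reP; exact: face_le fF.
move=> y z t y1 z1 t0 t1 fyz.
(* The weight is taken in [K]; being positive, it comes from a real. *)
have tE : t = emb s (re s t) by exact/ge0_reE/ltW.
have {}t0 : 0 < re s t by rewrite -(ltr_emb s) -tE rmorph0.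
have {}t1 : re s t < 1 by rewrite -(ltr_emb s) -tE rmorph1.
have reyz x : re s t * re s (y x) + (1 - re s t) * re s (z x) = re s (f x).
  rewrite fyz -!(re_embM s) -reD rmorphB rmorph1 -tE; congr (re s _).
have yN := (dual_ball_reP y).1 y1; have zN := (dual_ball_reP z).1 z1.
have eqf (h : dual Z) : (forall x, re s (h x) <= re s (f x)) -> h = f.
  move=> hf; apply: dual_re_inj => x.
  exact: (congr1 (fun k => k x) (scalar_le_eq (reL h) (reL f) hf)).
split; apply: eqf.
  apply: (face_extremal fF (reL y) (reL z) yN zN t0 t1) => x.
  by rewrite reyz.
apply: (face_extremal fF (reL z) (reL y) zN yN (t := 1 - re s t)).
- by rewrite subr_gt0.
- by rewrite ltrBlDr ltrDl.
- by move=> x; rewrite subKr addrC reyz.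
Qed.

End DualBall.

(** * States, the numerical radius and extreme tensors *)

Section NumericalRadius.
Context {R : realType} {K : numFieldType} (s : real_part R K).
Context {X : normedModType K}.
Implicit Types (T : bop X X) (f : dual X) (x : X).

Lemma id_bounded : (idfun : X -> X) \in @bounded_linear K X X.
Proof. by apply/asboolP; split=> //; exists 1 => x; rewrite mul1r. Qed.

Lemma numerical_radius_supremums T :
  (exists f x, [/\ dual_sphere f, sphere x & f x = 1]) ->
  supremums [set r | exists f x,
    [/\ dual_sphere f, sphere x, f x = 1 &
      r = `|f (T x)|]] (numerical_radius T).
Proof.
move=> [f0 [x0 [f01 x01 fx0]]]; apply: (supremum_nonneg s).
- by exists `|f0 (T x0)|, f0, x0.
- by move=> _ [f [x [_ _ _ ->]]].
have /asboolP[_ [M TM]] := bop_funP T.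
exists M => _ [f [x [f1 x1 _ ->]]].
have /(dual_ballP s)/(_ (T x))/le_trans : dual_ball f by rewrite /dual_ball /=
  f1.
by apply; have := TM x; rewrite [`|x|]x1 mulr1.
Qed.

Hypothesis hX : exists x : X, x != 0.
Hypothesis hw : is_norm (@numerical_radius K X).

(** Without states the identity would have numerical radius [supremum 0 set0 = 0], hence vanish
    because the numerical radius is a norm, although [X] is nonzero. *)
Lemma exists_state : exists f x, [/\ dual_sphere f, sphere x & f x = 1].
Proof.
apply: contrapT => no_state; have [x /eqP x0] := hX; apply: x0.
suff /(congr1 (fun T : bop X X => T x)) : Bop id_bounded = 0 by [].
apply: (is_norm_eq0 hw); rewrite /numerical_radius.
rewrite (_ : [set r | _] = set0) ?supremum0// -subset0 =>
  r [f [y [f1 y1 fy _]]].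
by apply: no_state; exists f, y.
Qed.

Lemma tensor_le f x T : dual_ball f -> sphere x -> `|f x| = 1 ->
  `|tensor hw f x T| <= `|T : Lw hw|.
Proof.
move=> f1 x1 fx; have fx0 : f x != 0 by rewrite -normr_eq0 fx oner_neq0.
have [ub _] := numerical_radius_supremums T exists_state.
have gE y : ((f x)^-1 *: f : dual X) y = (f x)^-1 * f y by [].
apply: ub; exists ((f x)^-1 *: f), x; split=> //.
- apply: (dual_sphereP s _ x1); last by rewrite gE mulVf// normr1.
  apply/(dual_ballP s) => y; rewrite gE normrM normfV fx invr1 mul1r.
  exact: (dual_ballP s f).1.
- by rewrite gE mulVf.
- by rewrite gE normrM normfV fx invr1 mul1r.
Qed.

Lemma extreme_tensor_le (phi : dual (Lw hw)) T :
  extreme_tensors hw phi -> `|phi T| <= `|T : Lw hw|.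
Proof. by move=> [f [x [[f1 _] x1 fx ->]]]; exact: tensor_le. Qed.

Lemma exists_extreme_tensor f x : extreme_points (@dual_ball K X) f ->
  sphere x -> `|f x| = 1 ->
  exists2 phi, extreme_tensors hw phi & (phi : Lw hw -> K) = tensor hw f x.
Proof.
move=> fE x1 fx.
have phiB : (tensor hw f x : Lw hw -> K^o) \in @bounded_linear K (Lw hw) K^o.
  apply/asboolP; split=> [a S T|]; first by rewrite /tensor /= linearP.
  by exists 1 => T; rewrite mul1r; apply: tensor_le => //; case: fE.
by exists (Bop phiB) => //; exists f, x.
Qed.

(* The scalar bringing [f (T x)] on the positive axis is absorbed in [x]: the
   tensor is [h] at [u *: x], so that only [h] itself has to be extreme. *)
Lemma extreme_tensors_norming T (c : R) :
  (forall phi, extreme_tensors hw phi -> re s (phi T) <= c) ->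
  re s `|T : Lw hw| <= c.
Proof.
move=> Tc; have [_ lub] := numerical_radius_supremums T exists_state.
rewrite -(ler_emb s) emb_re_norm; apply: lub => _ [f [x [f1 x1 fx ->]]].
pose p (y : realified s X) := re s `|y : X|.
have pS : sublinear p by exact: sublinear_renorm.
have [u u1 uf] := unit_rotation (f (T x)).
have re1 : re s 1 = 1 by rewrite -(rmorph1 (emb s)) re_emb.
have px : p x = 1 by rewrite /p x1.
have fp : forall y, re s (f y) <= p y.
  by apply/dual_ball_reP; rewrite /dual_ball /= f1.
have fL : scalar (fun y : realified s X => re s (f y)).
  exact: scalar_re (scalar_dual f).
pose y : realified s X := u *: T x.
pose x' : realified s X := x.
(* The first face consists of the functionals below [p] with value 1 at [x], among them the real
   part of [f]. A point extreme in its face at [y] is extreme below [p] and is at least as large as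
   [f] at [y]. *)
have pxF := face_of_face x' pS.
have [g [gL gle gF]] :=
  face_of_scalar (face_trans pxF (face_of_face y (face_sublinear pxF))).
have g_face z : g z <= face p x' z.
  exact: le_trans (gle z) (face_le (face_of_face y (face_sublinear pxF)) z).
have gx : 1 <= g x by rewrite -px; exact: (face_ge pS gL g_face).
have gy : re s (f y) <= g y.
  apply: le_trans (face_ge (face_sublinear pxF) gL gle).
  by apply: (le_face fL fp); rewrite fx px.
have [h h1 hg] := dual_of_re gL (face_le gF).
have hE : extreme_points (@dual_ball K X) h.
  apply/(extreme_dual_ballP s).
  by have -> : (fun z : realified s X => re s (h z)) = g by apply/funext.
have ux1 : sphere (u *: x) by rewrite /sphere /= normrZ u1 mul1r.
have hux : `|h (u *: x)| = 1.
  rewrite linearZ/= normrM u1 mul1r; apply/eqP; rewrite eq_le.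
  have := (dual_ballP s h).1 h1 x; rewrite [`|x|]x1 => ->/=.
  by rewrite (le_trans _ (re_le_norm s _))// hg -(rmorph1 (emb s)) ler_emb.
have [phi phiM phiE] := exists_extreme_tensor hE ux1 hux.
have := Tc _ phiM; rewrite phiE /tensor linearZ/= hg => gc.
have fy : f y = `|f (T x)| by rewrite -uf linearZ.
by rewrite -(emb_re_norm s) ler_emb -fy (le_trans gy).
Qed.

End NumericalRadius.

(** * Weak* convergence through real parts *)

Section WeakStar.
Context {R : realType} {K : numFieldType} (s : real_part R K).
Context {Z : normedModType K}.

(** Real parts suffice since the hypothesis also holds at [iu s *: x], and [norm_le_re] controls the
    modulus by these two real parts. *)
Lemma weak_star_cvg (F : set_system (dual Z)) (f : dual Z) : Filter F ->
  (forall x, (fun g : dual Z => re s (g x)) @ F --> re s (f x)) ->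
  F --> (f : weak_star Z).
Proof.
move=> FF Ff.
have {}Ff x : (fun g : dual Z => g x) @ F --> (f x : K^o).
  apply/cvgrPdist_lt => e e0.
  have e2 : 0 < re s e / 2.
    by rewrite divr_gt0// -(ltr_emb s) -ge0_reE ?ltW// rmorph0.
  have /cvgrPdist_lt/(_ _ e2) h1 := Ff x.
  have /cvgrPdist_lt/(_ _ e2) h2 := Ff (iu s *: x).
  near=> g; apply: le_lt_trans (norm_le_re s _) _.
  have iuE (h : dual Z) : iu s * h x = h (iu s *: x) by rewrite linearZ.
  rewrite mulrBr !iuE !reD !reN.
  rewrite [ltRHS](ge0_reE s (ltW e0)) ltr_emb [ltRHS]splitr ltrD//.
    by near: g.
  by near: g.
move=> A /= [_ [[B Bo <-] Bf BA]].
pose ev (g : dual Z) : {ptws Z -> K^o} := g : Z -> K^o.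
have evF : ev @ F --> ev f by apply/pointwise_cvgP.
apply: filterS BA _; apply: evF.
exact: open_nbhs_nbhs.
Unshelve. all: by end_near. Qed.

End WeakStar.

(** * The two scalar fields, and extreme functionals as weak* limits of extreme tensors *)

Lemma real_part_real (R : realType) : real_part R (R : numFieldType).
Proof.
apply: (@RealPart R R idfun id 0) => //.
- by move=> z; exact: ler_norm.
- by move=> z; rewrite mul0r subr0.
- by left.
Qed.

Lemma real_part_complex (R : realType) : real_part R (R[i] : numFieldType).
Proof.
apply: (@RealPart R R[i] (real_complex R) (@complex.Re R) 'i%C).
- by move=> r t; rewrite lecE /= eqxx.
- by move=> [a b] [c d].
- by move=> r [a b] /=; rewrite mul0r subr0.
- move=> z; apply: le_trans (normc_ge_Re z); rewrite lecE/= eqxx/=;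
  exact: ler_norm.
- by move=> [a b]; rewrite lecE /= => /andP[/eqP -> _].
- by move=> [a b]; apply/eqP; rewrite eq_complex /=; apply/andP; split;
  apply/eqP; ring.
- by right; rewrite -expr2 sqr_i.
Qed.

(** [milman] is applied with the tensors indexing themselves and the numerical radius as [N];
    [extreme_tensors_norming] says that they carry the whole dual ball. *)
Lemma extreme_subset_closure (R : realType) (K : numFieldType)
    (s : real_part R K) (X : normedModType K) (hX : exists x : X, x != 0)
    (hw : is_norm (@numerical_radius K X)) :
  extreme_points (@dual_ball K (Lw hw))
    `<=` weak_star_closure (extreme_tensors hw).
Proof.
move=> phi /[dup][[phi1 _]] /(extreme_dual_ballP s) phiF.
have reL (f : dual (Lw hw)) :
    scalar (fun T : realified s (Lw hw) => re s (f T)).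
  exact: scalar_re (scalar_dual f).
have [|||F [FF FM Fphi]] := @milman R (realified s (Lw hw)) (dual (Lw hw))
  (fun f T => re s (f T)) _ (extreme_tensors hw) _ _ _ (reL phi) phiF.
- by [].
- move=> f T fM; rewrite -(ler_emb s) emb_re_norm.
  by rewrite (le_trans (re_le_norm _ _))// (extreme_tensor_le s hX).
- move=> T c Tc; apply: le_trans (extreme_tensors_norming hX Tc).
  exact: (dual_ball_reP s phi).1.
(* Each neighbourhood of [phi] and the set of extreme tensors both belong to the proper filter [F],
   so they meet. *)
move=> A Aphi; apply: (@filter_ex _ F); apply: filterI => //.
exact: (weak_star_cvg _ Fphi).
Qed.

Theorem theorem2p3 (R : realType) (K : numFieldType)
    (hK : K = (R : numFieldType) \/ K = (R[i] : numFieldType))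
    (X : completeNormedModType K) (hX : exists x : X, x != 0)
    (hw : is_norm (@numerical_radius K X)) :
  extreme_points (@dual_ball K (Lw hw))
    `<=` weak_star_closure (extreme_tensors hw).
Proof.
have [s] : inhabited (real_part R K).
  case: hK => KE; rewrite KE; constructor.
    exact: real_part_real.
  exact: real_part_complex.
exact: (extreme_subset_closure s hX).
Qed.
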